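(* Let $X$ be an infinite regular cardinal and let $\mathcal C\supsetneq\mathcal U$ be a clone on $X$. Then there exists $n\geq 2$ such that $\mathcal C=\mathcal M_n$, where $\mathcal M_n=\langle\{m^n_2\}\cup T_1\rangle$.
   Context: $\mathcal O^{(n)}$ is the set of all functions $X^n\to X$, $\mathcal O=\bigcup_{n\geq 1}\mathcal O^{(n)}$. A clone is a subset of $\mathcal O$ containing all projections and closed under composition; $\langle\mathcal F\rangle$ is the smallest clone containing $\mathcal F$. A function $f\in\mathcal O^{(n)}$ is almost unary if there exist $F\in\mathcal O^{(1)}$ and $1\leq k\leq n$ such that $f(x_1,\ldots,x_n)<F(x_k)$ for all $(x_1,\ldots,x_n)\in X^n$ (here $<$ is the well-order of the cardinal $X$). $\mathcal U$ is the set of all almost unary functions (it is a clone), and $T_1=\mathcal U\cap\mathcal O^{(2)}$. $m^n_k(x_1,\ldots,x_n)$ denotes the $k$-th smallest entry of the tuple, i.e. $m^n_k(x_1,\ldots,x_n)=x_{j_k}$ if $x_{j_1}\leq\cdots\leq x_{j_n}$ with $\{j_1,\ldots,j_n\}=\{1,\ldots,n\}$. *)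

(* Defs.v *)
From mathcomp Require Import all_boot all_order.
From mathcomp Require Import boolp classical_sets functions cardinality wochoice.

Set Implicit Arguments.
Unset Strict Implicit.
Unset Printing Implicit Defensive.

Import Order.TTheory.

Local Open Scope order_scope.
Local Open Scope classical_set_scope.
Local Open Scope card_scope.

(* A cardinal is an initial ordinal. It is represented, up to order isomorphism,
   by a totally ordered type whose order is a well-order and none of whose
   proper initial segments is equipotent to the whole type. *)
Definition is_cardinal d (X : orderType d) : Prop :=
  well_order (<=%O : rel X) /\
  forall x : X, ~ ([set: X] #<= [set y : X | y < x]).

(* cf(X) = X: every cofinal subset has full cardinality. *)
Definition infinite_regular_cardinal d (X : orderType d) : Prop :=
  [/\ is_cardinal X,
      infinite_set [set: X] &
      forall A : set X, (forall x, exists2 a, A a & x <= a) -> [set: X] #<= A].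

Section Clones.
Variable X : Type.

(* An operation carries its arity, so that sets of operations of mixed arities
   are plain sets. Arity 0 is excluded by [operations] below. *)
Definition operation : Type := {n : nat & n.-tuple X -> X}.

Definition Op n (f : n.-tuple X -> X) : operation :=
  existT (fun n => n.-tuple X -> X) n f.

Definition operations_of_arity (n : nat) : set operation :=
  [set f | projT1 f = n].

Definition operations : set operation :=
  \bigcup_(n in [set n | (1 <= n)%N]) operations_of_arity n.

Definition projection n (k : 'I_n) : n.-tuple X -> X := fun x => tnth x k.

Definition composition m n (f : m.-tuple X -> X) (g : 'I_m -> n.-tuple X -> X) :
  n.-tuple X -> X := fun x => f [tuple g i x | i < m].

Definition is_clone (C : set operation) : Prop :=
  [/\ C `<=` operations,
      forall n (k : 'I_n), C (Op (projection k)) &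
      forall m n (f : m.-tuple X -> X) (g : 'I_m -> n.-tuple X -> X),
        C (Op f) -> (forall i, C (Op (g i))) -> C (Op (composition f g))].

Definition generated_clone (F : set operation) : set operation :=
  smallest is_clone F.

End Clones.

Section AlmostUnary.
Context {d : Order.disp_t} (X : orderType d).

Definition is_almost_unary n (f : n.-tuple X -> X) : Prop :=
  exists (F : X -> X) (k : 'I_n), forall x : n.-tuple X, f x < F (tnth x k).

Definition almost_unary : set (operation X) :=
  [set f | is_almost_unary (projT2 f)].

Definition T1 : set (operation X) := almost_unary `&` operations_of_arity 2.

(* Positions are counted from 0: k : 'I_n selects the (k+1)-st smallest entry. *)
Definition kth_smallest n (k : 'I_n) : n.-tuple X -> X :=
  fun x => tnth (sort_tuple <=%O x) k.

Lemma kth_smallestP n (x : n.-tuple X) (j : 'I_n -> 'I_n) (k : 'I_n) :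
  injective j ->
  (forall a b : 'I_n, (a <= b)%N -> tnth x (j a) <= tnth x (j b)) ->
  kth_smallest k x = tnth x (j k).
Proof.
move=> jI jx.
rewrite -[RHS](tnth_mktuple (fun i => tnth x (j i)) k) /kth_smallest.
congr (tnth _ k); apply: val_inj; apply: le_sorted_eq => /=; first exact: sort_le_sorted.
  apply/(sortedP (tnth x k)) => i; rewrite size_map size_enum_ord => ilt.
  have nthE (a : 'I_n) := nth_mktuple (fun i => tnth x (j i)) (tnth x k) a.
  rewrite (nthE (Ordinal (ltnW ilt))) (nthE (Ordinal ilt)).
  by apply: jx; rewrite /= leqnSn.
rewrite perm_sort -[X in perm_eq X](map_tnth_enum x) map_comp.
apply: perm_map; apply: uniq_perm; first exact: enum_uniq.
  by rewrite map_inj_uniq //; exact: enum_uniq.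
move=> i; rewrite mem_enum; apply/esym/mapP.
by exists (invF jI i); [exact: mem_enum | rewrite f_invF].
Qed.

(* [M_ n_ge2] is M_n: a proof of 2 <= n makes 1 an element of 'I_n, the position
   of the second smallest entry. *)
Definition M_ n (n_ge2 : (2 <= n)%N) : set (operation X) :=
  generated_clone ([set Op (@kth_smallest n (Ordinal n_ge2))] `|` T1).

End AlmostUnary.

Arguments almost_unary {d} X.
Arguments T1 {d} X.
Arguments M_ {d} X {n} n_ge2.

(* Main.v *)
Require Import Defs.
From mathcomp Require Import all_boot all_order.
From mathcomp Require Import boolp classical_sets functions cardinality.

(** Call a set [S] of coordinates dominating for [f] when [f] is bounded on
every set of tuples whose entries in [S] stay below a fixed bound. By regularity
the set of all coordinates dominates, and [f] is almost unary exactly when a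
single coordinate does. The proof rests on the fact that, above the almost
unary functions, a clone only sees dominating sets: if [f] is in the clone and
every set dominating [f] dominates [g], then [g] is in the clone
([clone_transfer], which also allows for identifications of coordinates).
Indeed, where [g x] is large compared with the entries of [x] in [B], the set [B]
does not dominate [f], so some tuple [w] that is small on [B] has
[g x <= f w]; each entry of [w] can be produced from [x] by an almost unary
function, and a function lying below a member of the clone is in the clone
([clone_minorant]).

For the operation m^r_2 the sets with two elements dominate, and this gives the
two halves of the theorem. First, if [r >= 2] non-dominating sets of a member of
the clone cover its coordinates, then m^r_2 is in the clone
([clone_second_smallest]); applied to the singletons of a function which is not
almost unary, this yields some m^r_2. Let [n] be the least such [r]. By
minimality, for [f] in the clone no fewer than [n] non-dominating sets cover the
coordinates. This covering condition yields a term [h] in m^n_2 and projections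
alone ([clone_threshold_term], as in the description of Post's infinite chains of
Boolean clones) such that no non-dominating set of [f] dominates [h]. So [f]
belongs to every clone that contains [h] and the almost unary functions.

It remains to generate all almost unary functions from the binary ones
([almost_unary_generated_by_T1]). There is no almost unary injection of
pairs, but there is one on the pairs [(x, y)] with [y <= x]; hence on the region
where the [i]-th entry is the largest a tuple can be coded by one value, and the
finitely many regions are glued by a maximum taken under the common bound. *)

Set Implicit Arguments.
Unset Strict Implicit.
Unset Printing Implicit Defensive.

Import Order.TTheory.

Local Open Scope order_scope.
Local Open Scope classical_set_scope.
Local Open Scope card_scope.

(** * Bounded subsets of a regular cardinal *)

Section BoundedSets.
Context {d : Order.disp_t} {X : orderType d} (Xreg : infinite_regular_cardinal X).
Implicit Types (a b c x y z : X) (A B : set X).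

Let X_cofinal A : (forall x, exists2 a, A a & x <= a) -> [set: X] #<= A.
Proof. by case: Xreg => _ _; apply. Qed.

Let X_initial x : ~ ([set: X] #<= [set y : X | y < x]).
Proof. by case: Xreg => -[_ +] _ _; apply. Qed.

Lemma exists_gt a : exists b, a < b.
Proof.
apply: contrapT => noub; case: Xreg => _ Xinf _; apply: Xinf.
apply: (@card_le_finite _ _ _ [set a]); last exact: finite_set1.
apply: X_cofinal => x; exists a => //; rewrite leNgt; apply/negP => ax.
by apply: noub; exists x.
Qed.

Lemma exists_minimum A : A !=set0 -> exists2 z, A z & forall x, A x -> z <= x.
Proof.
move=> [x Ax]; case: Xreg => -[wo _] _ _.
have [|z [[Az zmin] _]] := wo (mem A); first by exists x; apply/mem_set.
by exists z => [|y Ay]; [exact: set_mem | apply: zmin; exact/mem_set].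
Qed.

Lemma exists_bottom : exists c, forall x, c <= x.
Proof.
case: Xreg => _ Xinf _.
have [|c _ cP] := @exists_minimum setT; last by exists c => x; exact: cP.
apply: contrapT => X0; apply: Xinf; rewrite (_ : setT = set0)// -subset0 => x _.
by apply: X0; exists x.
Qed.

Definition bounded A := exists b, forall y, A y -> y < b.

Lemma sub_bounded A B : A `<=` B -> bounded B -> bounded A.
Proof. by move=> AB [b bP]; exists b => y /AB/bP. Qed.

Lemma bounded1 a : bounded [set a].
Proof. by have [b ab] := exists_gt a; exists b => y ->. Qed.

Lemma bounded0 : bounded set0.
Proof. by have [c _] := exists_bottom; exists c. Qed.

Lemma boundedU A B : bounded A -> bounded B -> bounded (A `|` B).
Proof.
move=> [a aP] [b bP]; exists (Order.max a b) => y; rewrite lt_max.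
by case=> [/aP ->|/bP ->]; rewrite ?orbT.
Qed.

(** The form in which regularity is used throughout: strict upper bounds of
the [F x] with [x <= a] form the image of a proper initial segment, too small to
be cofinal. *)
Lemma bounded_bigcup_initial (F : X -> set X) a :
  (forall x, bounded (F x)) -> bounded (\bigcup_(x in [set x | x <= a]) F x).
Proof.
move=> /choice[b bP]; apply: contrapT => nbd.
have [a' aa'] := exists_gt a.
apply: (@X_initial a'); apply: (@card_le_trans _ _ _ (b @` [set x | x <= a])).
  apply: X_cofinal => z; apply: contrapT => zP; apply: nbd.
  exists z => y [x /= xa Fxy]; apply: lt_le_trans (bP _ _ Fxy) _.
  rewrite leNgt; apply/negP => zb; apply: zP.
  by exists (b x); [exists x | exact: ltW].
apply: card_le_trans (card_image_le _ _) (subset_card_le _) => x /= xa.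
exact: le_lt_trans xa aa'.
Qed.

Lemma bounded_bigcup_fin (T : finType) (F : T -> set X) :
  (forall t, bounded (F t)) -> bounded (\bigcup_t F t).
Proof.
move=> FP; suff H (s : seq T) : bounded (\bigcup_(t in [set` s]) F t).
  by apply: sub_bounded (H (enum T)) => y [t _ Fy]; exists t; rewrite //= mem_enum.
elim: s => [|t s IH]; first by apply: sub_bounded bounded0 => y [].
apply: sub_bounded (boundedU (FP t) IH) => y [u /=].
rewrite inE => /orP[/eqP -> Fy|us Fy]; [by left|by right; exists u].
Qed.

Lemma bounded_range_initial n (f : n.-tuple X -> X) a :
  bounded (f @` [set x | forall i, tnth x i <= a]).
Proof.
elim: n f => [f|n IH f].
  by apply: sub_bounded (bounded1 (f [tuple])) => y [x _ <-]; rewrite (tuple0 x).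
have IHu u := IH (fun x : n.-tuple X => f [tuple of u :: x]) : bounded _.
have := bounded_bigcup_initial a IHu.
apply: sub_bounded => y [x xa <-].
exists (thead x); first by rewrite /= /thead; exact: xa.
exists [tuple of behead x]; last by rewrite -tuple_eta.
by move=> i; move: (xa (lift ord0 i)); rewrite {1}(tuple_eta x) tnthS.
Qed.

Lemma well_founded_lt : well_founded (fun x y => x < y).
Proof.
move=> x; apply: contrapT => nacc.
have [|z zP zmin] := @exists_minimum [set x | ~ Acc (fun x y => x < y) x].
  by exists x.
apply: zP; split => y yz; apply: contrapT => /zmin; by rewrite leNgt yz.
Qed.

(** Recursion along the well-order with a relation in place of a step
function. Off the initial segment below [x] the history passed to [P] takes
arbitrary values, here those of the identity, so [P x r] is meant to look at [r]
below [x] only. *)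
Lemma transfinite_choice (P : X -> (X -> X) -> X -> Prop) :
  (forall x r, exists b, P x r b) ->
  exists s : X -> X, forall x, P x (fun y => if y < x then s y else y) (s x).
Proof.
move=> PP; have /choice[step stepP] x : exists f, forall r, P x r (f r).
  by have [f fP] := choice (PP x); exists f.
pose ext x (r : forall y, y < x -> X) y := 
  if pselect (y < x) is left yx then r y yx else y.
pose F x r := step x (ext x r).
pose s := Fix well_founded_lt (fun=> X) F.
exists s => x; suff -> : s x = step x (fun y => if y < x then s y else y) by [].
rewrite /s Fix_eq => [|y f g fg]; last first.
  by congr (F y _); do 2!apply: functional_extensionality_dep => ?.
congr (step x _); apply/funext => y; rewrite /ext.
by case: pselect => [->|/negP/negbTE ->].
Qed.

(** A final segment is cofinal, hence equipotent to the whole cardinal. *)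
Lemma tail_embedding : exists e : X -> X -> X,
  (forall a, injective (e a)) /\ (forall a x, a < e a x).
Proof.
suff /choice[e eP] : forall a, exists e : X -> X, injective e /\ forall x, a < e x.
  by exists e; split=> a; have [] := eP a.
move=> a; have /card_leP[f] : [set: X] #<= [set x | a < x].
  apply: X_cofinal => x; have [b] := exists_gt (Order.max x a).
  by rewrite gt_max => /andP[xb ab]; exists b => //; exact: ltW.
pose g (x : X) : {x | x \in [set: X]} := exist _ x (mem_set I).
exists (fun x => val (f (g x))); split=> [x y /val_inj|x].
  by move=> /(@inj _ _ _ f) => /(_ (mem_set I) (mem_set I)) [].
by have := valP (f (g x)); rewrite inE.
Qed.

(** A pairing function is bounded in terms of one argument only if the
other one is kept below it. The codes of the pairs with first component [x] are
placed in a block beginning at [s x], where [s] is chosen by recursion beyond all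
earlier blocks, so that no cardinal arithmetic is needed. The last clause also
separates these codes from the values taken on pairs with [x < y]. *)
Lemma triangular_pairing : exists p : X -> X -> X,
  [/\ forall x, bounded (range (p x)),
      forall x y, y <= x -> x <= p x y &
      forall x y x' y', y <= x -> p x y = p x' y' -> x = x' /\ y = y'].
Proof.
have [bot botP] := exists_bottom; have [e [e_inj e_gt]] := tail_embedding.
pose block b x := e b @` [set y | y <= x].
have block_bounded b x : bounded (block b x).
  apply: sub_bounded (bounded_bigcup_initial x (fun y => bounded1 (e b y))).
  by move=> _ [y yx <-]; exists y.
have [|s sP] := @transfinite_choice (fun x r b =>
    x < b /\ forall y z, y < x -> block (r y) y z -> z < b).
  move=> x r; have [b bP] := boundedU (bounded1 x)
    (bounded_bigcup_initial x (fun y => block_bounded (r y) y)).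
  exists b; split=> [|y z yx yz]; first by apply: bP; left.
  by apply: bP; right; exists y => //; exact: ltW.
have s_gt x : x < s x by have [] := sP x.
have s_lt x y x' : y <= x -> x < x' -> e (s x) y < s x'.
  move=> yx xx'; have [_ /(_ x)] := sP x'; rewrite xx'; apply=> //.
  by exists y.
(* The value [bot] is not a code, since [e a] only takes values above [a]. *)
exists (fun x y => if y <= x then e (s x) y else bot); split.
- move=> x; apply: sub_bounded (boundedU (bounded1 bot) (block_bounded (s x) x)).
  by move=> _ [y _ <-]; case: ifP => yx; [right; exists y|left].
- by move=> x y ->; apply/ltW/lt_trans/e_gt/s_gt.
move=> x y x' y' yx; rewrite yx; case: ifP => yx' exy; last first.
  by have := e_gt (s x) y; rewrite exy ltNge botP.
suff xx' : x = x' by split=> //; apply: (@e_inj (s x)); rewrite exy xx'.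
case: (ltgtP x x') => // [/(s_lt _ _ _ yx)|/(s_lt _ _ _ yx')].
  by rewrite exy ltNge (ltW (e_gt _ _)).
by rewrite -exy ltNge (ltW (e_gt _ _)).
Qed.

End BoundedSets.

(** * Clones *)

Definition binary (X : Type) (b : X -> X -> X) : 2.-tuple X -> X :=
  fun t => b (tnth t ord0) (tnth t ord_max).

Section CloneFacts.
Context {X : Type}.
Implicit Types K F : set (operation X).

Lemma clone_arity_gt0 K n (f : n.-tuple X -> X) :
  is_clone K -> K (Op f) -> (0 < n)%N.
Proof. by case=> Kop _ _ /Kop[m /= m0 nm]; rewrite -nm in m0. Qed.

Lemma clone_proj K n (k : 'I_n) : is_clone K -> K (Op (fun x => tnth x k)).
Proof. by case=> _ Kproj _; exact: Kproj. Qed.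

Lemma clone_comp K m n (f : m.-tuple X -> X) (g : 'I_m -> n.-tuple X -> X) :
  is_clone K -> K (Op f) -> (forall i, K (Op (g i))) ->
  K (Op (fun x => f [tuple g i x | i < m])).
Proof. by case=> _ _; apply. Qed.

Lemma clone_binary K n (b : X -> X -> X) (g h : n.-tuple X -> X) :
  is_clone K -> K (Op (binary b)) -> K (Op g) -> K (Op h) ->
  K (Op (fun x => b (g x) (h x))).
Proof.
move=> Kc Kb Kg Kh.
have := @clone_comp _ _ _ _ (fun i => if i == ord0 then g else h) Kc Kb.
rewrite /binary; under eq_fun do rewrite !tnth_mktuple.
by apply=> i; case: ifP.
Qed.

Lemma operations_is_clone : is_clone (@operations X).
Proof.
split=> // [n [k kn]|m n f g [m' m'0 mE] gP].
  by exists n => //=; apply: leq_ltn_trans kn.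
move: mE m'0 => /= <- m0; have [n' n'0 /= nE] := gP (Ordinal m0).
by exists n' => //; rewrite nE.
Qed.

Lemma generated_is_clone F : F `<=` @operations X -> is_clone (generated_clone F).
Proof.
move=> Fop; split=> [f|n k K [[_ Kproj _] _]|m n f g Ff Fg K KF].
- by apply; split=> //; exact: operations_is_clone.
- exact: Kproj.
- by have [[_ _ Kcomp] _] := KF; apply: Kcomp => [|i]; [apply: Ff|apply: Fg].
Qed.

End CloneFacts.

(** * Almost unary functions are generated by binary ones *)

Section AlmostUnaryFacts.
Context {d : Order.disp_t} {X : orderType d} (Xreg : infinite_regular_cardinal X).
Implicit Types (K : set (operation X)).

Lemma almost_unaryI n (f : n.-tuple X -> X) k (B : X -> set X) :
  (forall u, bounded (B u)) -> (forall x, B (tnth x k) (f x)) -> is_almost_unary f.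
Proof. by move=> /choice[F FP] fB; exists F, k => x; exact/FP/fB. Qed.

Lemma almost_unary_sub_operations : almost_unary X `<=` @operations X.
Proof. by move=> [n f] [_ [[k kn] _]]; exists n => //=; apply: leq_ltn_trans kn. Qed.

Lemma T1_binary (b : X -> X -> X) :
  (forall x, bounded (range (b x))) -> T1 X (Op (binary b)).
Proof.
by move=> bP; split=> //; apply: (almost_unaryI (k := ord0) bP) => x;
  exists (tnth x ord_max).
Qed.

Section GeneratedByT1.
Variables (K : set (operation X)) (Kc : is_clone K) (T1K : T1 X `<=` K).

Lemma clone_T1_unary n (phi : X -> X) (g : n.-tuple X -> X) :
  K (Op g) -> K (Op (fun x => phi (g x))).
Proof.
move=> Kg; apply: (@clone_binary _ _ _ (fun x _ => phi x) g g) => //.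
apply/T1K/T1_binary => x.
by apply: sub_bounded (bounded1 Xreg (phi x)) => _ [y _ <-].
Qed.

(** On the region where the [i]-th entry is the largest, the other entries
are absorbed one at a time by the triangular pairing, which starts with the
[i]-th entry and never decreases, so its second argument stays below its first. The
code even separates the points of the region from those outside it, which lets a
unary function applied to [q] detect the region. *)
Lemma clone_T1_code n (i : 'I_n) : exists q : n.-tuple X -> X, K (Op q) /\
  forall x x', (forall j, tnth x j <= tnth x i) -> q x = q x' -> x = x'.
Proof.
have [p [p_bd p_ge p_inj]] := triangular_pairing Xreg.
suff H (s : seq 'I_n) : exists q : n.-tuple X -> X, K (Op q) /\
    forall x, (forall j, tnth x j <= tnth x i) -> tnth x i <= q x /\
      forall x', q x = q x' -> {in s, forall j, tnth x j = tnth x' j}.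
  have [q [Kq qP]] := H (enum 'I_n); exists q; split=> // x x' xi qq.
  by apply: eq_from_tnth => j; apply: (qP x xi).2; rewrite ?mem_enum.
elim: s => [|j s [q [Kq qP]]].
  by exists (fun x => tnth x i); split; [exact: clone_proj|].
exists (fun x => p (q x) (tnth x j)); split.
  apply: (clone_binary (b := p) Kc _ Kq (clone_proj j Kc)).
  exact/T1K/T1_binary.
move=> x xi; have [qx qx_inj] := qP x xi.
have xjq : tnth x j <= q x by apply: le_trans qx.
split=> [|x' /(p_inj _ _ _ _ xjq)[qq jj] k]; first exact: le_trans (p_ge _ _ xjq).
by rewrite inE => /predU1P[->//|]; exact: qx_inj.
Qed.

(** [part s] agrees with [f] on the regions listed in [s] and is [bot]
elsewhere. One region is handled by a unary function of its code; two parts are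
joined by a maximum. The maximum is not almost unary, but all parts lie below
[F] of the [c]-th entry, and after pairing this bound with the first part, cutting
the second part off at the bound costs nothing and makes the operation almost
unary. *)
Lemma almost_unary_generated_by_T1 : almost_unary X `<=` K.
Proof.
move=> [n f] [F [c fF]]; rewrite /= in f F c fF *.
have [bot botP] := exists_bottom Xreg.
have [p [p_bd p_ge p_inj]] := triangular_pairing Xreg.
pose maximal_at (x : n.-tuple X) i := [forall j, tnth x j <= tnth x i].
pose part s x := if has (maximal_at x) s then f x else bot.
have part_le s x : part s x <= F (tnth x c).
  by rewrite /part; case: ifP => _; [exact/ltW/fF|exact: botP].
have part1 i : K (Op (part [:: i])).
  have [q [Kq q_inj]] := clone_T1_code i.
  have /choice[phi phiP] z : exists v, forall x, q x = z -> part [:: i] x = v.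
    have [[x [xi <-]]|nx] := pselect (exists x, maximal_at x i /\ q x = z).
      exists (f x) => y /esym/q_inj <-; last exact/forallP.
      by rewrite /part /= xi.
    exists bot => x qxz; rewrite /part /= orbF ifN //.
    by apply/negP => xi; apply: nx; exists x.
  rewrite (_ : part _ = fun x => phi (q x)); first exact: clone_T1_unary.
  by apply/funext => x; exact: phiP.
have /choice[decode decodeP] z :
    exists ua, forall u a, a <= u -> p u a = z -> ua = (u, a).
  have [[u [a [au pz]]]|nz] := pselect (exists u a, a <= u /\ p u a = z).
    by exists (u, a) => u' a' a'u' /esym; rewrite -pz => /p_inj[//|-> ->].
  by exists (bot, bot) => u a au pz; case: nz; exists u, a.
pose join z b := if b <= (decode z).1 then Order.max (decode z).2 b else bot.
have T1join : T1 X (Op (binary join)).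
  apply: T1_binary => z; have [b bP] := boundedU (bounded1 Xreg bot)
    (boundedU (bounded1 Xreg (decode z).1) (bounded1 Xreg (decode z).2)).
  exists b => _ [y _ <-]; rewrite /join; case: ifP => [yz|_]; last by apply: bP; left.
  rewrite gt_max; apply/andP; split; first by apply: bP; right; right.
  by apply: le_lt_trans yz _; apply: bP; right; left.
suff KS s : K (Op (part s)).
  rewrite (_ : f = part (enum 'I_n)); first exact: KS.
  apply/funext => x; rewrite /part ifT //; apply/hasP.
  exists [arg max_(i > c) tnth x i]%O; first by rewrite mem_enum.
  by case: arg_maxP => // i _ imax; apply/forallP => j; exact: imax.
elim: s => [|i s IH]; first exact: (clone_T1_unary (fun=> bot) (clone_proj c Kc)).
rewrite (_ : part _ = fun x => join (p (F (tnth x c)) (part [:: i] x)) (part s x)).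
  apply: (clone_binary (b := join) Kc (T1K T1join) _ IH).
  apply: (clone_binary (b := p) Kc _ _ (part1 i)); first exact/T1K/T1_binary.
  exact: (clone_T1_unary F (clone_proj c Kc)).
apply/funext => x; rewrite /join (decodeP _ _ _ (part_le _ _) erefl) /= part_le.
rewrite /part /= orbF; case: (maximal_at x i); case: (has _ s) => /=; apply/esym.
- exact: maxxx.
- exact: max_l.
- exact: max_r.
- exact: maxxx.
Qed.

End GeneratedByT1.
End AlmostUnaryFacts.

(** * Second smallest entries *)

Section SecondSmallest.
Context {d : Order.disp_t} {X : orderType d}.

Lemma kth_smallest_le n (k : 'I_n) (x : n.-tuple X) a :
  (kth_smallest k x <= a) = (k < #|[pred i | (tnth x i <= a)%O]|)%N.
Proof.
have ss : sorted <=%O (sort <=%O x) := sort_le_sorted x.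
rewrite [#|_|](_ : _ = count (<= a) (sort <=%O x)); last first.
  have /permP -> : perm_eq (sort <=%O x) x by rewrite perm_sort.
  rewrite -[in RHS](map_tnth_enum x) count_map cardE size_filter.
  by rewrite enumT; apply: eq_count.
rewrite /kth_smallest (tnth_nth (tnth x k)) /=.
case: ltnP => [/(nth_count_le _ ss)|ge_k]; first exact.
by apply/negbTE; rewrite -ltNge nth_count_gt // ge_k size_sort size_tuple ltn_ord.
Qed.

Lemma second_smallest_leP n (n2 : (1 < n)%N) (x : n.-tuple X) a :
  reflect (exists i j, [/\ tnth x i <= a, tnth x j <= a & i != j])
          (kth_smallest (Ordinal n2) x <= a).
Proof. by rewrite kth_smallest_le; exact: card_gt1P. Qed.

End SecondSmallest.

(** * Dominating sets of coordinates *)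

Section Domination.
Context {d : Order.disp_t} {X : orderType d} (Xreg : infinite_regular_cardinal X).

Definition dominates n (f : n.-tuple X -> X) (S : {set 'I_n}) :=
  forall a, bounded (f @` [set x | forall i, i \in S -> tnth x i <= a]).

Lemma dominatesS n (f : n.-tuple X -> X) (S S' : {set 'I_n}) :
  S \subset S' -> dominates f S -> dominates f S'.
Proof.
move=> /fintype.subsetP SS' Sf a; apply: sub_bounded (Sf a) => _ [x xa <-].
by exists x => // i /SS'; exact: xa.
Qed.

Lemma dominatesT n (f : n.-tuple X -> X) : dominates f [set: 'I_n]%SET.
Proof.
move=> a; apply: sub_bounded (bounded_range_initial Xreg f a) => _ [x xa <-].
by exists x => // i; apply: xa; rewrite finset.in_setT.
Qed.

Lemma dominates1 n (f : n.-tuple X -> X) k :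
  dominates f [set k]%SET -> is_almost_unary f.
Proof.
move=> /(almost_unaryI (f := f) (k := k)); apply=> x.
by exists x => // i; rewrite finset.in_set1 => /eqP ->.
Qed.

Lemma not_dominates n (f : n.-tuple X -> X) S : ~ dominates f S ->
  exists a, forall z, exists w, (forall i, i \in S -> tnth w i <= a) /\ z <= f w.
Proof.
move=> nS; apply: contrapT => nP; apply: nS => a; apply: contrapT => nb.
apply: nP; exists a => z; apply: contrapT => nw; apply: nb; exists z => _ [x xa <-].
by rewrite ltNge; apply/negP => zf; apply: nw; exists x.
Qed.

Section Transfer.
Variables (K : set (operation X)) (Kc : is_clone K) (UK : almost_unary X `<=` K).

(** [g x] is the minimum of [g x] and [f x], and the minimum of [g x] and [z]
is almost unary in [(z, x)]. *)
Lemma clone_minorant n (f g : n.-tuple X -> X) :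
  K (Op f) -> (forall x, g x <= f x) -> K (Op g).
Proof.
move=> Kf gf.
pose h (t : n.+1.-tuple X) :=
  Order.min (g [tuple tnth t (lift ord0 i) | i < n]) (tnth t ord0).
have Kh : K (Op h).
  apply: UK; apply: (almost_unaryI (k := ord0) (B := fun z => [set y | y <= z])).
    by move=> z; have [b zb] := exists_gt Xreg z; exists b => y /le_lt_trans; apply.
  by move=> x; rewrite /= ge_min lexx orbT.
pose arg (i : 'I_n.+1) := if unlift ord0 i is Some j then fun x => tnth x j else f.
have := clone_comp (g := arg) Kc Kh.
rewrite (_ : (fun x => _) = g); first apply.
  by move=> i; rewrite /arg; case: unlift => // j; exact: clone_proj.
apply/funext => x; rewrite /h tnth_mktuple /arg unlift_none.
rewrite (_ : [tuple _ | i < n] = x); first exact: min_l.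
by apply: eq_from_tnth => i; rewrite !tnth_mktuple liftK.
Qed.

(** Bound [g], for each entry value [a], by [beta a] on all the sets of tuples
with entries below [a] in a dominating set. The set [small x] of those [i] with
[beta (tnth x i) <= g x] cannot dominate [g]: its largest entry would contradict the
choice of [beta], and if the empty set dominates then [g] is almost unary anyway.
Hence its preimage under [j] does not dominate [f], and [f w >= g x] for some [w]
that is bounded there by a constant. Off the preimage [g x], and so [w], is bounded in terms of the entry of [x] with index
[j i]. Thus all entries of [w] are almost unary functions of [x]. *)
Lemma clone_transfer k r (f : k.-tuple X -> X) (g : r.-tuple X -> X)
    (j : 'I_k -> 'I_r) :
  K (Op f) ->
  (forall S : {set 'I_r}, dominates f (j @^-1: S) -> dominates g S) ->
  K (Op g).
Proof.
move=> Kf fg.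
have k0 := j (Ordinal (clone_arity_gt0 Kc Kf)).
have [/(dominatesS (finset.sub0set _))/dominates1 g0|ng0] := pselect (dominates g finset.set0).
  by apply: UK; apply: g0; exact: k0.
have /choice[beta betaP] a : exists b, forall S, dominates g S ->
    forall x, (forall i, i \in S -> tnth x i <= a) -> g x < b.
  have [|b bP] := @bounded_bigcup_fin _ _ Xreg {set 'I_r} (fun S =>
    [set y | dominates g S /\ exists2 x, (forall i, i \in S -> tnth x i <= a) & y = g x]).
    move=> S; have [Sg|nSg] := pselect (dominates g S).
      by apply: sub_bounded (Sg a) => _ [_ [x xa ->]]; exists x.
    by apply: sub_bounded (bounded0 Xreg) => y [].
  by exists b => S Sg x xa; apply: bP; exists S => //; split=> //; exists x.
have /choice[a0 a0P] (S : {set 'I_r}) : exists a, ~ dominates g S ->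
    forall z, exists w, (forall i, j i \in S -> tnth w i <= a) /\ z <= f w.
  have [Sg|nSg] := pselect (dominates g S).
    by have [c _] := exists_bottom Xreg; exists c.
  have [|a aP] := @not_dominates _ f (j @^-1: S); first by move=> /fg.
  exists a => _ z; have [w [wa zw]] := aP z; exists w; split=> // i jiS.
  by apply: wa; rewrite inE.
have /choice[w wP] (Sz : {set 'I_r} * X) : exists w, ~ dominates g Sz.1 ->
    (forall i, j i \in Sz.1 -> tnth w i <= a0 Sz.1) /\ Sz.2 <= f w.
  have [Sg|nSg] := pselect (dominates g Sz.1); last first.
    by have [w wP] := a0P _ nSg Sz.2; exists w.
  by have [c _] := exists_bottom Xreg; exists [tuple c | i < k].
pose small x := [set i | beta (tnth x i) <= g x]%SET.
have small_ndom x : ~ dominates g (small x).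
  move=> dom; have [s0|[i0 i0s]] := finset.set_0Vmem (small x); first by rewrite s0 in dom.
  have [i is_ imax] : exists2 i, i \in small x &
      forall i', i' \in small x -> tnth x i' <= tnth x i.
    by case: (arg_maxP (tnth x) i0s) => i is_ imax; exists i.
  have := betaP (tnth x i) _ dom x imax; rewrite ltNge.
  by move: is_; rewrite inE => ->.
pose y i x := tnth (w (small x, g x)) i.
have Ky i : K (Op (y i)).
  apply: UK; apply: (almost_unaryI (k := j i) (B := fun u =>
    \bigcup_S ([set z | z <= a0 S] `|`
      \bigcup_(z in [set z | z <= beta u]) [set tnth (w (S, z)) i]))).
    move=> u; apply: bounded_bigcup_fin => // S; apply: boundedU.
      by have [b ab] := exists_gt Xreg (a0 S); exists b => z /le_lt_trans; apply.
    by apply: bounded_bigcup_initial => // z; exact: bounded1.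
  move=> x; exists (small x) => //; have [wa _] := wP (small x, g x) (small_ndom x).
  have [jis|jis] := boolP (j i \in small x); first by left; exact: wa.
  by right; exists (g x) => //=; move: jis; rewrite inE -ltNge => /ltW.
apply: clone_minorant (clone_comp Kc Kf Ky) _ => x.
rewrite (_ : [tuple _ | i < k] = w (small x, g x)).
  exact: (wP (small x, g x) (small_ndom x)).2.
by apply: eq_from_tnth => i; rewrite tnth_mktuple.
Qed.

(** Sending each coordinate to the index of a set containing it turns the
non-dominating sets of the covering into singletons, and a set which dominates
after this identification has two elements, hence dominates m^r_2. *)
Lemma clone_second_smallest k r (r2 : (1 < r)%N) (f : k.-tuple X -> X)
    (A : 'I_r -> {set 'I_k}) :
  K (Op f) -> (forall s, ~ dominates f (A s)) -> (forall i, exists s, i \in A s) ->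
  K (Op (kth_smallest (Ordinal r2))).
Proof.
move=> Kf nA /choice[j jA]; apply: (clone_transfer (j := j) Kf) => S Sf a.
have [/card_gt1P[s [t [sS tS st]]]|S1] := ltnP 1 #|S|.
  have [b ab] := exists_gt Xreg a; exists b => _ [x xa <-].
  apply: le_lt_trans ab; apply/second_smallest_leP.
  by exists s, t; split=> //; exact: xa.
have [s Ss] : exists s, S \subset [set s]%SET.
  have [->|[s sS]] := finset.set_0Vmem S; first by exists (Ordinal r2); exact: finset.sub0set.
  by exists s; apply/fintype.subsetP => t tS; rewrite finset.in_set1 (card_le1_eqP S1 t s).
case: (nA s); apply: dominatesS Sf; apply/fintype.subsetP => i.
by rewrite inE => /(fintype.subsetP Ss); rewrite finset.in_set1 => /eqP <-.
Qed.

End Transfer.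
End Domination.

(** * Terms in the second smallest entry *)

(** If fewer than [n] sets are given, a projection to a coordinate outside all
of them works. Otherwise drop each of the first [n] sets in turn and take terms
[h j] for the shorter lists: a given set occurs in all but at most one of these
lists, so all but one of the [h j x] are at least [b], and so is their second
smallest value. *)
Lemma clone_threshold_term d (X : orderType d) (K : set (operation X))
    n (n2 : (1 < n)%N) k (Z : seq {set 'I_k}) :
  is_clone K -> K (Op (kth_smallest (Ordinal n2))) ->
  (forall s : seq {set 'I_k}, (size s < n)%N -> {subset s <= Z} ->
     exists i, forall A, A \in s -> i \notin A) ->
  exists h : k.-tuple X -> X, K (Op h) /\
    forall A x b, A \in Z -> (forall i, i \notin A -> b <= tnth x i) -> b <= h x.
Proof.
move=> Kc Km; have [N] := ubnP (size Z); elim: N Z => // N IH Z ZN Zs.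
have [Zn|nZ] := ltnP (size Z) n.
  have [//|i iZ] := Zs Z Zn; exists (fun x => tnth x i); split; first exact: clone_proj.
  by move=> A x b /iZ iA; apply.
pose drop1 (j : 'I_n) := take j Z ++ drop j.+1 Z.
have drop1_sub j : {subset drop1 j <= Z}.
  by move=> A; rewrite mem_cat => /orP[/mem_take|/mem_drop].
have mem_drop1 A (j : 'I_n) : A \in Z -> j != index A Z :> nat -> A \in drop1 j.
  move=> AZ; rewrite mem_cat neq_ltn => /orP[jA|Aj]; last by rewrite in_take // Aj.
  rewrite -(nth_index A AZ) -(subnKC jA) -nth_drop mem_nth ?orbT //.
  by rewrite size_drop ltn_sub2r ?index_mem // (leq_ltn_trans jA) ?index_mem.
have /choice[h hP] (j : 'I_n) : exists h : k.-tuple X -> X, K (Op h) /\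
    forall A x b, A \in drop1 j -> (forall i, i \notin A -> b <= tnth x i) -> b <= h x.
  apply: IH => [|s sn sZ]; last by apply: Zs => // A /sZ/drop1_sub.
  have jZ : (j < size Z)%N by exact: leq_trans nZ.
  rewrite size_cat size_take jZ size_drop.
  by move: ZN; rewrite -{1}(subnKC jZ) addSn ltnS; apply.
exists (fun x => kth_smallest (Ordinal n2) [tuple h j x | j < n]); split.
  by apply: clone_comp => // j; case: (hP j).
move=> A x b AZ xb; rewrite leNgt; apply/negP => mb.
have hA (j : 'I_n) : tnth [tuple h j x | j < n] j < b -> j = index A Z :> nat.
  rewrite tnth_mktuple => hb; apply/eqP; apply: contraLR hb => jA.
  by rewrite -leNgt; apply: (hP j).2 xb; exact: mem_drop1.
have /second_smallest_leP[i [j [im jm /eqP[]]]] :=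
  lexx (kth_smallest (Ordinal n2) [tuple h j x | j < n]).
by apply: val_inj; rewrite /= !hA //; [exact: le_lt_trans jm mb|exact: le_lt_trans im mb].
Qed.

(** * Classification of the clones above the almost unary functions *)

Theorem theorem57 (d : Order.disp_t) (X : orderType d)
    (X_regular : infinite_regular_cardinal X)
    (C : set (operation X)) (C_clone : is_clone C)
    (UC : almost_unary X `<` C) :
  exists (n : nat) (n_ge2 : (2 <= n)%N), C = M_ X n_ge2.
Proof.
have {UC} [UC [g [Cg ng]]] :
    almost_unary X `<=` C /\ exists g, C g /\ ~ almost_unary X g.
  case: UC => UC nCU; split=> //; apply: contrapT => ng; apply: nCU => g Cg.
  by apply: contrapT => nUg; apply: ng; exists g.
pose has_m r := exists r2 : (1 < r)%N, C (Op (@kth_smallest _ X r (Ordinal r2))).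
have ex_m : exists r, `[< has_m r >].
  case: g Cg ng => k g Cg ng; have k0 := clone_arity_gt0 C_clone Cg.
  have nd i : ~ dominates g [set i]%SET by move=> /dominates1.
  have k1 : (1 < k)%N.
    case: k k0 g Cg ng nd => [//|[|//]] _ g _ _ nd; case: (nd ord0).
    rewrite (_ : [set ord0]%SET = [set: 'I_1]%SET); first exact: dominatesT.
    by apply/setP => i; rewrite !inE [i]ord1.
  exists k; apply/asboolP; exists k1.
  apply: (clone_second_smallest X_regular C_clone UC _ Cg nd) => i.
  by exists i; rewrite finset.in_set1.
have [n /asboolP[n2 Cm] n_min] := ex_minnP ex_m; exists n, n2.
apply/seteqP; split; last first.
  apply: smallest_sub => // f [->//|[Uf _]]; exact: UC.
have M_clone : is_clone (M_ X n2).
  apply: generated_is_clone => f [->|[Uf _]].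
    by exists n => //; exact: ltnW.
  exact: almost_unary_sub_operations.
have UM : almost_unary X `<=` M_ X n2.
  apply: almost_unary_generated_by_T1 => // f T1f K [_]; apply; by right.
move=> [k f] Cf; have k0 := clone_arity_gt0 C_clone Cf.
(* [h] is unbounded on tuples that are constant on a set not dominating [f]. *)
have [s sn|h [Mh hP]] := @clone_threshold_term _ _ _ _ n2 _
    (enum [pred S | `[< ~ dominates f S >]]) M_clone (fun K KF => KF.2 _ (or_introl erefl)).
  move=> nd; apply: contrapT => scover.
  have {scover} cover i : exists2 A, A \in s & i \in A.
    apply: contrapT => niA; apply: scover; exists i => A As.
    by apply/negP => iA; apply: niA; exists A.
  have {}nd A : A \in s -> ~ dominates f A by move=> /nd; rewrite mem_enum => /asboolP.
  (* A cover by one set is excluded because the set of all coordinates dominates. *)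
  have [s1|s1] := ltnP 1 (size s); last first.
    have [A As _] := cover (Ordinal k0); apply: (nd A As).
    rewrite (_ : A = [set: 'I_k]%SET); first exact: dominatesT.
    apply/setP => i; rewrite inE; have [B Bs iB] := cover i.
    by case: s s1 As Bs {sn nd cover} => [|B' [|]] //= _; rewrite !inE => /eqP -> /eqP <-.
  suff /asboolP/n_min : has_m (size s) by rewrite leqNgt sn.
  exists s1; apply: (clone_second_smallest X_regular C_clone UC _ (A := tnth (in_tuple s)) Cf).
    by move=> t; apply: nd; exact: mem_tnth.
  by move=> i; have [A /(tnthP (in_tuple s))[t ->] iA] := cover i; exists t.
apply: (clone_transfer X_regular M_clone UM (j := id) Mh) => S Sh.
apply: contrapT => nS; have [c _] := exists_bottom X_regular.
have [b bP] := Sh c.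
pose x := [tuple if i \in S then c else b | i < k].
suff : (b <= h x)%O.
  rewrite leNgt bP //; exists x => // i; rewrite inE tnth_mktuple => ->; exact: lexx.
apply: (hP S) => [|i iS]; first by rewrite mem_enum; exact/asboolP.
by rewrite tnth_mktuple (negbTE iS).
Qed.
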